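(* Let $\varepsilon \in (0,1/2]$ be the solution of $1 - H(\varepsilon) = \varepsilon/8$ (so $\varepsilon \approx 0.3735$), and let $\delta = \varepsilon/8 \approx 0.047$ and $c = \frac{1}{4}\log_2 \frac{9}{5} \approx 0.212$. Then the number $V(3,d)$ of vertices of $\Omega_3^d$ satisfies $$\log_2 V(3,d) \geq c\, 2^{\delta d}\,(1+o(1)) \quad \text{as } d \to \infty.$$ In particular, $V(3,d)$ grows doubly exponentially in $d$.
   Context: $H(x) = -x\log_2 x - (1-x)\log_2(1-x)$ is the binary entropy function. For integers $n,d \geq 1$ let $I_n^d = \{\alpha = (\alpha_1,\ldots,\alpha_d) : \alpha_i \in \{1,\ldots,n\}\}$. A $d$-dimensional matrix of order $n$ is an array $A = (a_\alpha)_{\alpha \in I_n^d}$ of real numbers. A line of $A$ is the set of entries obtained by fixing all but one coordinate of the index and letting the remaining coordinate range over $\{1,\ldots,n\}$. A matrix is polystochastic if all its entries are nonnegative and the sum of entries in each line equals $1$. $\Omega_n^d$ denotes the convex polytope (in $\mathbb{R}^{n^d}$) of all $d$-dimensional polystochastic matrices of order $n$, and $V(n,d)$ is its number of vertices (extreme points). *)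

(* Defs.v *)
From HB Require Import structures.
From mathcomp Require Import all_boot all_order all_algebra.
From mathcomp Require Import finmap all_classical all_reals all_analysis.
Set Implicit Arguments. Unset Strict Implicit. Unset Printing Implicit Defensive.
Import Order.TTheory GRing.Theory Num.Theory.
Local Open Scope classical_set_scope.
Local Open Scope ring_scope.

Definition index (n d : nat) := {ffun 'I_d -> 'I_n}.

Definition mdmatrix (R : realType) (n d : nat) := {ffun index n d -> R}.

Definition setc (n d : nat) (a : index n d) (i : 'I_d) (k : 'I_n) : index n d :=
  [ffun j => if j == i then k else a j].

(* Polystochastic: nonnegative entries, each line sums to 1.
   The line through alpha in direction i is {setc alpha i k | k}. *)
Definition polystochastic (R : realType) (n d : nat) (A : mdmatrix R n d) : Prop :=
  (forall a, 0 <= A a) /\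
  (forall (i : 'I_d) (a : index n d), \sum_(k < n) A (setc a i k) = 1).

Definition Omega (R : realType) (n d : nat) : set (mdmatrix R n d) :=
  [set A | polystochastic A].

Definition vertex (R : realType) (n d : nat) (A : mdmatrix R n d) : Prop :=
  @Omega R n d A /\
  forall (B C : mdmatrix R n d) (t : R), @Omega R n d B -> @Omega R n d C ->
    0 < t < 1 -> (forall a, A a = t * B a + (1 - t) * C a) -> B = C.

(* V(n,d): the number of vertices (the vertex set of a polytope is finite). *)
Definition V (R : realType) (n d : nat) : nat :=
  (#|` fset_set [set A : mdmatrix R n d | vertex A] |)%fset.

Definition log2 (R : realType) (x : R) : R := ln x / ln 2.

Definition H (R : realType) (x : R) : R :=
  - x * log2 x - (1 - x) * log2 (1 - x).

(* Main.v *)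
(* Let [bump x y] be [(-1/2)] to the Hamming distance of [x] and [y]: its line
   sums vanish, it peaks at [x] and decays exponentially.  Take a ternary code
   [C] with [2 ^ q] words, [q] the integer part of [d / 16], whose minimum
   distance is so large that bumps at different words hardly interact.  For
   every [T], adding to the constant matrix [1/3] the bumps at the words of [C],
   with coefficient [2/3] on [T] and [-1/3] off [T], and shrinking slightly to
   stay nonnegative, gives a polystochastic matrix whose restriction to [C] is
   within total distance [1/4] of the indicator of [T].  So the projection of
   the polytope to the coordinates in [C] nearly fills the cube: some vertex
   [v] maximizing the corresponding linear functional has [T] as the set of
   [x] in [C] with [v x > 1/2], whence at least [2 ^ 2 ^ q] vertices.  As
   [eps / 8 <= 1 / 16], this is more than enough. *)
Require Import Defs.
From HB Require Import structures.
From mathcomp Require Import all_boot all_order all_algebra.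
From mathcomp Require Import all_classical all_reals all_analysis.
From mathcomp Require Import ring lra zify.
Set Implicit Arguments. Unset Strict Implicit. Unset Printing Implicit Defensive.
Import Order.TTheory GRing.Theory Num.Theory.
Local Open Scope ring_scope.

(** * Vertices, linear functionals and supports *)

Section Vertices.
Context {R : realType} {n d : nat}.
Implicit Types (A B C v w : mdmatrix R n d) (a x y : Defs.index n d).

Lemma setc_id a i : setc a i (a i) = a.
Proof. by apply/ffunP => j; rewrite ffunE; case: eqP => [->|]. Qed.

Lemma polystochastic_ge0 A a : polystochastic A -> 0 <= A a.
Proof. by case. Qed.

Lemma polystochastic_le1 A a : (0 < d)%N -> polystochastic A -> A a <= 1.
Proof.
move=> d_gt0 [A0 /(_ (Ordinal d_gt0) a) <-].
rewrite (bigD1 (a (Ordinal d_gt0))) //= setc_id lerDl.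
by apply: sumr_ge0.
Qed.

(** All line sums of [B - C] vanish, so a nonnegative difference would be zero. *)
Lemma polystochastic_sub_lt0 B C : (0 < d)%N ->
  polystochastic B -> polystochastic C -> B <> C -> exists a, B a - C a < 0.
Proof.
move=> d_gt0 OB OC BC; apply: contrapT => noneg; apply: BC; apply/ffunP => a.
have D0 x : 0 <= B x - C x by rewrite leNgt; apply/negP => ?; apply: noneg; exists x.
pose i := Ordinal d_gt0.
have : \sum_(k < n) (B (setc a i k) - C (setc a i k)) = 0.
  by rewrite sumrB (proj2 OB) (proj2 OC) subrr.
move/(psumr_eq0P (fun k _ => D0 (setc a i k)))/(_ (a i) isT).
by rewrite setc_id => /eqP; rewrite subr_eq0 => /eqP.
Qed.

Lemma polystochastic_line A B C (s : R) :
  polystochastic A -> polystochastic B -> polystochastic C ->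
  (forall a, 0 <= A a + s * (B a - C a)) ->
  polystochastic ([ffun a => A a + s * (B a - C a)] : mdmatrix R n d).
Proof.
move=> OA OB OC ge0; split=> [a|i a]; first by rewrite ffunE.
under eq_bigr do rewrite ffunE.
rewrite big_split -mulr_sumr sumrB /= (proj2 OA) (proj2 OB) (proj2 OC).
by rewrite subrr mulr0 addr0.
Qed.

(* Move from a non-vertex along the direction of a segment containing it, in
   the sense that does not decrease the functional, until an entry vanishes. *)
Lemma polystochastic_shrink (g : Defs.index n d -> R) A :
  (0 < d)%N -> polystochastic A -> ~ vertex A ->
  exists A', [/\ polystochastic A', \sum_a g a * A a <= \sum_a g a * A' a &
    ([set a | A' a != 0] \proper [set a | A a != 0])%SET].
Proof.
move=> d_gt0 OA nvA.
have [B [C [t [OB OC t01 AE BC]]]] : exists B C t, [/\ polystochastic B,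
    polystochastic C, 0 < t < 1, (forall a, A a = t * B a + (1 - t) * C a) & B <> C].
  apply: contrapT => h; apply: nvA; split=> // B C t OB OC t01 AE.
  by apply: contrapT => BC; apply: h; exists B, C, t.
wlog gD : B C t OB OC t01 AE BC / 0 <= \sum_a g a * (B a - C a).
  move=> th; have [|/ltW gD] := leP 0 (\sum_a g a * (B a - C a)).
    exact: th AE BC.
  apply: (th C B (1 - t)) => //.
  - by move: t01 => /andP[? ?]; apply/andP; split; lra.
  - by move=> a; rewrite AE; ring.
  - by move=> CB; apply: BC.
  - rewrite -oppr_le0 -sumrN (le_trans _ gD) // le_eqVlt; apply/orP; left.
    by apply/eqP; apply: eq_bigr => a _; ring.
have [t0 t1] := andP t01.
(* As [0 < t < 1], a zero of [A] is a common zero of [B] and [C]; hence the move cannot enlarge the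
   support. *)
have A0D a : A a = 0 -> B a - C a = 0.
  move=> Aa0; have := AE a.
  have := polystochastic_ge0 a OB; have := polystochastic_ge0 a OC.
  rewrite Aa0 => C0 B0 /esym/eqP.
  have t'0 : 0 < 1 - t by rewrite subr_gt0.
  rewrite paddr_eq0; first 2 last; try exact: mulr_ge0 (ltW _) _.
  rewrite !mulf_eq0 (gt_eqF t0) (gt_eqF t'0) /= => /andP[/eqP-> /eqP->].
  exact: subrr.
have [a0 Da0] := polystochastic_sub_lt0 d_gt0 OB OC BC.
(* Ratio test: along [B - C], no entry reaches zero before the one at [a1]. *)
have [a1 Da1 min1] :
    exists2 a1, B a1 - C a1 < 0 & forall a, B a - C a < 0 ->
      A a1 / - (B a1 - C a1) <= A a / - (B a - C a).
  by case: (@arg_minP _ _ _ a0 (fun a => B a - C a < 0)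
    (fun a => A a / - (B a - C a))) => // a1 ? ?; exists a1.
pose s := A a1 / - (B a1 - C a1).
have s0 : 0 <= s by rewrite divr_ge0 ?(polystochastic_ge0 _ OA) // oppr_ge0 ltW.
have OA' : polystochastic ([ffun a => A a + s * (B a - C a)] : mdmatrix R n d).
  apply: polystochastic_line => // a; have [D0|D0] := leP 0 (B a - C a).
    exact: addr_ge0 (polystochastic_ge0 _ OA) (mulr_ge0 s0 D0).
  have := min1 _ D0; rewrite -/s ler_pdivlMr ?oppr_gt0 //.
  by rewrite mulrN -subr_ge0 opprK.
exists [ffun a => A a + s * (B a - C a)]; split=> //.
  under [leRHS]eq_bigr do rewrite ffunE mulrDr mulrCA.
  by rewrite big_split /= -mulr_sumr lerDl mulr_ge0.
apply/properP; split.
  apply/fintype.subsetP => a; rewrite !inE ffunE; apply: contraNN => /eqP Aa0.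
  by rewrite Aa0 (A0D _ Aa0) mulr0 addr0.
exists a1; rewrite !inE ?ffunE.
  by apply: contraTN Da1 => /eqP/A0D->; rewrite ltxx.
rewrite negbK /s invrN mulrN mulNr divfK ?subrr //.
by rewrite lt_eqF.
Qed.

(** Induction on the size of the support. *)
Lemma exists_vertex_ge (g : Defs.index n d -> R) A :
  (0 < d)%N -> polystochastic A ->
  exists2 v, vertex v & \sum_a g a * A a <= \sum_a g a * v a.
Proof.
move=> d_gt0; have [k] := ubnP #|[set a | A a != 0]%SET|.
elim: k A => // k IHk A; rewrite ltnS => suppA OA.
have [vA|nvA] := pselect (vertex A); first by exists A.
have [A' [OA' leA /proper_card suppA']] := polystochastic_shrink g d_gt0 OA nvA.
have [v vv lev] := IHk A' (leq_trans suppA' suppA) OA'.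
by exists v => //; apply: le_trans lev.
Qed.

(* If the supports agree, the segment from [w] to [v] extends beyond [v], so a
   vertex [v] must coincide with [w]. *)
Lemma vertex_supp_inj v w : (0 < d)%N -> vertex v -> vertex w ->
  [set a | v a != 0]%SET = [set a | w a != 0]%SET -> v = w.
Proof.
move=> d_gt0 [Ov vert] [Ow _] /setP supp.
(* Entries are at most 1, so [p] is a lower bound for every nonzero entry of [v]. *)
pose p := \prod_(a | v a != 0) v a.
have p0 : 0 < p.
  by apply: prodr_gt0 => a ?; rewrite lt_def polystochastic_ge0 ?andbT.
have ple a : v a != 0 -> p <= v a.
  move=> va; rewrite /p (bigD1 a) //= ler_piMr ?polystochastic_ge0 //.
  by apply: prodr_ile1 => b _; rewrite polystochastic_ge0 ?polystochastic_le1.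
have p1 : p <= 1.
  by apply: prodr_ile1 => b _; rewrite polystochastic_ge0 ?polystochastic_le1.
(* Chosen so that [v] is [p / 2] times [w] plus [1 - p / 2] times the extended point. *)
pose s := p / (2 - p).
have s0 : 0 < s by rewrite divr_gt0 //; lra.
have OC : polystochastic ([ffun a => v a + s * (v a - w a)] : mdmatrix R n d).
  apply: polystochastic_line => // a; have := supp a; rewrite !inE.
  have [->|va] := eqVneq (v a) 0.
    by move/esym/negbT; rewrite negbK => /eqP->; rewrite subrr mulr0 addr0.
  move=> _; have := ple _ va; have := polystochastic_le1 a d_gt0 Ow.
  have := polystochastic_ge0 a Ow => w0 w1 pv.
  have -> : v a + s * (v a - w a) = (2 * v a - p * w a) / (2 - p).
    by rewrite /s; field; lra.
  by apply: divr_ge0; [nra|lra].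
have wE : w = [ffun a => v a + s * (v a - w a)].
  apply: vert (p / 2) Ow OC _ _.
    by apply/andP; split; lra.
  by move=> a; rewrite ffunE /s; field; lra.
apply/ffunP => a; have := congr1 (fun B : mdmatrix R n d => B a) wE.
rewrite /= ffunE => wa; have : (1 + s) * (v a - w a) = 0.
  by rewrite mulrDl mul1r addrAC -wa subrr.
by move/eqP; rewrite mulf_eq0 gt_eqF ?addr_gt0 // subr_eq0 => /eqP.
Qed.

(** A vertex is determined by its support. Finiteness matters since [fset_set] is empty on infinite
    sets. *)
Lemma finite_vertices : (0 < d)%N ->
  finite_set [set A : mdmatrix R n d | vertex A]%classic.
Proof.
move=> d_gt0; pose supp (A : mdmatrix R n d) := [set a | A a != 0]%SET.
pose of_supp S := xget [ffun=> 0] [set A | vertex A /\ supp A = S]%classic.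
apply: (@sub_finite_set _ _ (of_supp @` setT));
  last exact/finite_image/finite_finset.
move=> A vA; exists (supp A) => //; rewrite /of_supp.
case: xgetP => [B _ [vB suppB]|/(_ A)[]//]; exact: vertex_supp_inj.
Qed.

End Vertices.

(** * Bumps and separated ternary codes *)

Section Bump.
Context (R : realType) (d : nat).
Implicit Types (a x y : Defs.index 3 d) (C T : {set Defs.index 3 d}).

Definition bump x y : R := \prod_i (if y i == x i then 1 else - 2^-1).

Lemma norm_bump x y : `|bump x y| = \prod_i (if y i == x i then 1 else 2^-1).
Proof.
rewrite normr_prod; apply: eq_bigr => i _; case: ifP => _; first by rewrite normr1.
by rewrite normrN ger0_norm // invr_ge0.
Qed.

Lemma bumpxx x : bump x x = 1.
Proof. by rewrite /bump big1 // => i _; rewrite eqxx. Qed.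

Lemma sum_ord3_cond (i : 'I_3) (p q : R) :
  \sum_(k < 3) (if k == i then p else q) = p + q + q.
Proof.
rewrite (bigD1 i) //= eqxx -addrA; congr (_ + _).
rewrite (eq_bigr (fun=> q)) => [|k /negbTE-> //].
rewrite sumr_const (_ : #|_| = 2%N) ?mulr2n //.
by rewrite -[RHS]/(3.-1) -[in RHS](card_ord 3) -(cardC1 i); apply: eq_card.
Qed.

Lemma bump_line i a x : \sum_(k < 3) bump x (setc a i k) = 0.
Proof.
pose p := \prod_(j | j != i) (if a j == x j then 1 else - 2^-1) : R.
have E k : bump x (setc a i k) = (if k == x i then 1 else - 2^-1) * p.
  rewrite /bump (bigD1 i) //= ffunE eqxx; congr (_ * _).
  by apply: eq_bigr => j /negbTE ji; rewrite ffunE ji.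
under eq_bigr do rewrite E.
by rewrite -mulr_suml sum_ord3_cond; field.
Qed.

(** The sum factors over the coordinates, each giving 1 + 1/2 + 1/2. *)
Lemma sum_norm_bump x : \sum_y `|bump x y| = 2 ^+ d.
Proof.
under eq_bigr do rewrite norm_bump.
rewrite -(bigA_distr_bigA (fun i k => if k == x i then 1 else 2^-1 : R)).
under eq_bigr do rewrite sum_ord3_cond.
by rewrite prodr_const card_ord; congr (_ ^+ _); field.
Qed.

(* The triangle inequality, as [`|bump x y|] is [2] to minus the distance. *)
Lemma norm_bump_triangle x x' y : `|bump x y| * `|bump x' y| <= `|bump x x'|.
Proof.
rewrite !norm_bump -big_split /=; apply: ler_prod => i _; apply/andP; split.
  by apply: mulr_ge0; case: ifP => _; lra.
have [yx|yx] := eqVneq (y i) (x i); have [yx'|yx'] := eqVneq (y i) (x' i).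
- by rewrite -yx -yx' eqxx; lra.
- by case: ifP => _; lra.
- by case: ifP => _; lra.
- by case: ifP => _; lra.
Qed.

Lemma norm_bump_neq x y : x != y -> `|bump x y| <= 2^-1.
Proof.
move=> xy; have [i yx] : exists i, y i != x i.
  apply/existsP; apply: contraNT xy => /existsPn h.
  by apply/eqP/ffunP => i; apply/esym/eqP; rewrite -[_ == _]negbK; apply: h.
rewrite norm_bump (bigD1 i) //= (negbTE yx) ler_piMr ?invr_ge0 //.
by apply: prodr_ile1 => j _; case: ifP => _; lra.
Qed.

(* Gilbert-Varshamov: a greedy choice is never blocked, since the mass
   [2 ^+ d] of each [bump x] bounds the volume of the balls. *)
Lemma exists_code (kappa : R) (m : nat) : kappa < 1 ->
  m%:R * 2 ^+ d < kappa * 3 ^+ d ->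
  exists2 C : {set Defs.index 3 d}, #|C| = m &
    {in C &, forall x y, x != y -> `|bump x y| <= kappa}.
Proof.
move=> k1; elim: m => [|m IHm] mk.
  by exists finset.set0; rewrite ?cards0 // => x; rewrite inE.
have [|C cardC sep] := IHm.
  by apply: le_lt_trans mk; rewrite ler_wpM2r ?exprn_ge0 // ler_nat.
have [y yfar] : exists y, forall x, x \in C -> `|bump x y| <= kappa.
  apply: contrapT => h; suff : kappa * 3 ^+ d <= m%:R * 2 ^+ d.
    rewrite leNgt (le_lt_trans _ mk) // ler_wpM2r ?exprn_ge0 //.
    by rewrite ler_nat.
  have -> : m%:R * 2 ^+ d = \sum_y \sum_(x in C) `|bump x y|.
    rewrite exchange_big /=; under eq_bigr do rewrite sum_norm_bump.
    by rewrite sumr_const cardC mulr_natl.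
  have -> : kappa * 3 ^+ d = \sum_(y : Defs.index 3 d) kappa.
    by rewrite sumr_const card_ffun !card_ord -[RHS]mulr_natr natrX.
  apply: ler_sum => y _.
  have [x xC kx] : exists2 x, x \in C & kappa < `|bump x y|.
    apply: contrapT => h'; apply: h; exists y => x xC; rewrite leNgt.
    by apply/negP => kx; apply: h'; exists x.
  rewrite (bigD1 x) //=; apply: (le_trans (ltW kx)).
  by rewrite lerDl sumr_ge0.
have yC : y \notin C.
  by apply: contraL k1 => /yfar; rewrite bumpxx normr1 leNgt.
exists (y |: C)%SET; first by rewrite cardsU1 yC cardC.
have bumpC x z : `|bump x z| = `|bump z x|.
  by rewrite !norm_bump; apply: eq_bigr => i _; rewrite eq_sym.
move=> x z /setU1P[->|xC] /setU1P[->|zC]; rewrite ?eqxx // => xz.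
- by rewrite bumpC; apply: yfar.
- exact: yfar.
- exact: sep.
Qed.

(** * Polystochastic matrices near the corners of a cube *)

Section Separated.
Variables (C : {set Defs.index 3 d}) (tau : R).
Hypotheses (tau_ge0 : 0 <= tau) (tau_le1 : tau <= 1).
Hypothesis sepC :
  {in C &, forall x y, x != y -> `|bump x y| <= tau ^+ 2}.

Let nu : R := #|C|%:R * tau.

Let nu_ge0 : 0 <= nu. Proof. by rewrite mulr_ge0. Qed.

(** Adding 1/3 turns it into the indicator of [T]. *)
Let coef T x : R := if x \in T then 2 / 3 else - (1 / 3).

Let norm_coef T x : `|coef T x| <= 2 / 3.
Proof.
by rewrite /coef; case: ifP => _; rewrite ler_norml; apply/andP; split; lra.
Qed.

(** The sum can fall to [- (1 + 2 * nu) / 3], whence the scaling factor. *)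
Let corner T : mdmatrix R 3 d :=
  [ffun y => 1 / 3 + (1 + 2 * nu)^-1 * \sum_(x in C) coef T x * bump x y].

Let far_sum_le T (P : pred (Defs.index 3 d)) y :
  (forall x, x \in C -> P x -> `|bump x y| <= tau) ->
  `|\sum_(x in C | P x) coef T x * bump x y| <= 2 / 3 * nu.
Proof.
move=> far; apply: le_trans (ler_norm_sum _ _ _) _; rewrite big_mkcondr.
rewrite /nu mulrCA [leRHS]mulr_natl -sumr_const; apply: ler_sum => x xC.
by case: ifP => Px; [rewrite normrM ler_pM ?far|rewrite mulr_ge0].
Qed.

Let near_sum T x : x \in C ->
  `|\sum_(x' in C) coef T x' * bump x' x - coef T x| <= 2 / 3 * nu.
Proof.
move=> xC; rewrite (bigD1 x) //= bumpxx mulr1 addrAC subrr add0r.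
apply: far_sum_le => x' x'C x'x; apply: le_trans (sepC x'C xC x'x) _.
by rewrite expr2 ler_piMr.
Qed.

(* At most one bump is not small at [y], since two points of [C] cannot both be
   close to [y]; that bump alone contributes at least [-1/3]. *)
Let sum_ge T y : - (1 / 3) - 2 / 3 * nu <= \sum_(x in C) coef T x * bump x y.
Proof.
have [[x0 x0C x0y]|nox] :=
  pselect (exists2 x, x \in C & tau < `|bump x y|); last first.
  have := @far_sum_le T xpredT y; under eq_bigl do rewrite andbT.
  rewrite ler_norml => far.
  have /far/andP[? _] x : x \in C -> true -> `|bump x y| <= tau.
    by move=> xC _; rewrite leNgt; apply/negP => xy; apply: nox; exists x.
  lra.
rewrite (bigD1 x0) //=.
have far : `|\sum_(x in C | x != x0) coef T x * bump x y| <= 2 / 3 * nu.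
  apply: far_sum_le => x xC xx0; rewrite leNgt; apply/negP => xy.
  (* Two bumps above [tau] at [y] have a product above [tau ^+ 2], which explains the square in
     [sepC]. *)
  have := norm_bump_triangle x x0 y; apply/negP; rewrite -ltNge.
  by apply: le_lt_trans (sepC xC x0C xx0) _; rewrite expr2 ltr_pM.
(* At its own centre the bump is 1 and the coefficient at least -1/3; elsewhere the bump is at most
   1/2 in size and the coefficient at most 2/3. *)
have : - (1 / 3) <= coef T x0 * bump x0 y.
  have [->|/norm_bump_neq x0y'] := eqVneq x0 y.
    by rewrite bumpxx mulr1 /coef; case: ifP => _; lra.
  have : `|coef T x0 * bump x0 y| <= 2 / 3 * 2^-1 by rewrite normrM ler_pM.
  by rewrite ler_norml => /andP[+ _]; lra.
by move: far; rewrite ler_norml => /andP[? _]; lra.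
Qed.

Let polystochastic_corner T : polystochastic (corner T).
Proof.
have a0 : 0 < 1 + 2 * nu by have := nu_ge0; lra.
split=> [y|i y].
  rewrite ffunE -(@ler_pM2l _ (1 + 2 * nu)) // mulr0 mulrDr mulVKf ?gt_eqF //.
  by have := sum_ge T y; lra.
under eq_bigr do rewrite ffunE.
rewrite big_split /= sumr_const card_ord -mulr_sumr exchange_big /=.
rewrite [X in _^-1 * X]big1 => [|x _];
  last by rewrite -mulr_sumr bump_line mulr0.
by rewrite mulr0 addr0 -mulr_natr; field.
Qed.

(* The deviation of [corner T] from the indicator of [T] at [x]. *)
Let corner_dev T x : x \in C ->
  (x \in T)%:R - (-1) ^+ (x \notin T) * corner T x <= 2 * nu.
Proof.
move=> xC; have := near_sum T xC; rewrite ffunE.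
set S := \sum_(_ in C) _; rewrite ler_norml => /andP[S1 S2].
have a0 : 0 < 1 + 2 * nu by have := nu_ge0; lra.
rewrite -(@ler_pM2l _ (1 + 2 * nu)) //.
have := mulr_ge0 nu_ge0 nu_ge0; move: S1 S2; rewrite /coef.
set A := 1 / 3 + _.
have aE : (1 + 2 * nu) * A = (1 + 2 * nu) / 3 + S by rewrite /A; field; lra.
by case: (x \in T) => S1 S2 nn; rewrite /= ?expr0 ?expr1; lra.
Qed.

(** Maximize with sign 1 on [T] and -1 on the rest of [C]. Entries lie between 0 and 1, so the
    deviations of [v] from the indicator of [T] are nonnegative; they sum to less than 1/2, hence
    each is below 1/2. *)
Lemma exists_vertex_pattern T : (0 < d)%N -> #|C|%:R * (2 * nu) < 2^-1 ->
  exists2 v : mdmatrix R 3 d, vertex v &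
    {in C, forall x, (2^-1 < v x) = (x \in T)}.
Proof.
move=> d_gt0 small.
pose sg x : R := (-1) ^+ (x \notin T).
have [v vv] := exists_vertex_ge (fun x => if x \in C then sg x else 0)
  d_gt0 (polystochastic_corner T).
have E (A : mdmatrix R 3 d) :
    \sum_x (if x \in C then sg x else 0) * A x = \sum_(x in C) sg x * A x.
  by rewrite [RHS]big_mkcond; apply: eq_bigr => x _; case: ifP; rewrite ?mul0r.
rewrite !{}E => lev; exists v => // x xC.
have Ov : polystochastic v by case: vv.
have dev_ge0 y : 0 <= (y \in T)%:R - sg y * v y.
  have := polystochastic_ge0 y Ov; have := polystochastic_le1 y d_gt0 Ov.
  by rewrite /sg; case: (y \in T) => /=; lra.
have : \sum_(y in C) ((y \in T)%:R - sg y * v y) < 2^-1.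
  apply: le_lt_trans small; rewrite mulr_natl -sumr_const.
  apply: le_trans (ler_sum _ (fun y yC => corner_dev T yC)).
  by rewrite !sumrB lerB.
rewrite (bigD1 x) //= => /(le_lt_trans _) => /(_ ((x \in T)%:R - sg x * v x)).
rewrite lerDl sumr_ge0 // => /(_ isT); rewrite /sg.
by case: (x \in T) => /= ?; [apply/idP|apply/negbTE; rewrite -leNgt]; lra.
Qed.

(** The threshold 1/2 recovers a subset [T] of [C] from its vertex. *)
Lemma V_ge_exp2 : (0 < d)%N -> #|C|%:R * (2 * nu) < 2^-1 ->
  (2 ^ #|C| <= V R 3 d)%N.
Proof.
move=> d_gt0 small.
have [f fP] := choice (fun T => let: ex_intro2 v vv vT :=
  exists_vertex_pattern T d_gt0 small in ex_intro (fun v => vertex v /\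
    {in C, forall x, (2^-1 < v x) = (x \in T)}) v (conj vv vT)).
rewrite -card_powerset cardE -(size_map f); apply: uniq_leq_size.
  rewrite map_inj_in_uniq ?enum_uniq // => S T; rewrite !mem_enum !powersetE.
  move=> /fintype.subsetP SC /fintype.subsetP TC fST; apply/setP => x.
  have [xC|xC] := boolP (x \in C).
    by rewrite -(proj2 (fP S)) // -(proj2 (fP T)) // fST.
  by rewrite (contraNF (SC x)) // (contraNF (TC x)).
move=> v /mapP[T _ ->]; rewrite in_fset_set; last exact: finite_vertices.
by apply: mem_set; case: (fP T).
Qed.

End Separated.
End Bump.

(** * Choice of parameters and the final estimate *)

Theorem theorem5 (R : realType) (eps : R) :
  0 < eps <= 1 / 2 -> 1 - H eps = eps / 8 ->
  let delta := eps / 8 in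
  let c := 1 / 4 * log2 (9 / 5 : R) in
  forall eta : R, 0 < eta ->
    exists N : nat, forall d : nat, (N <= d)%N ->
      c * (2 `^ (delta * d%:R)) * (1 - eta) <= log2 ((V R 3 d)%:R).
Proof.
(* The bound 48 forces [q >= 3], so that [5 * q + 6 < 8 * q] when the code is built. *)
move=> /andP[eps0 eps1] _ delta c eta eta0; exists 48%N => d d48.
pose q := (d %/ 16)%N.
have qd : (16 * q <= d < 16 * q.+1)%N by rewrite /q; lia.
have q3 : (3 <= q)%N by rewrite /q; lia.
(* With [2 ^ q] words this makes [#|C| * (2 * nu)] equal to 1/4. *)
pose tau : R := 2 ^- (2 * q + 3).
have tau0 : 0 < tau by rewrite invr_gt0 exprn_gt0.
have tau1 : tau < 1 by rewrite invf_lt1 ?exprn_gt0 // exprn_egt1 ?ltr1n // addn3.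
have [||C cardC sepC] := @exists_code R d (tau ^+ 2) (2 ^ q)%N.
- by rewrite exprn_ilt1 // ltW.
- rewrite /tau exprVn ltr_pdivlMl ?exprn_gt0 // natrX -exprM -!exprD -!natrX.
  rewrite ltr_nat.
  (* [9 > 8] makes [(3 / 2) ^ (16 q)] at least [2 ^ (8 q)]. *)
  apply: (@leq_trans (2 ^ (3 * (8 * q) + (d - 16 * q)))).
    by rewrite ltn_exp2l //; lia.
  rewrite -[leqRHS](_ : 3 ^ (2 * (8 * q) + (d - 16 * q)) = _)%N; last first.
    by congr (_ ^ _)%N; lia.
  rewrite (expnD 2) (expnD 3) (expnM 2) (expnM 3).
  apply: leq_mul; first by rewrite leq_exp2r //; lia.
  by case: (d - 16 * q)%N => // e; rewrite leq_exp2r.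
have V_ge : (2 ^ (2 ^ q) <= V R 3 d)%N.
  rewrite -cardC; apply: (V_ge_exp2 (ltW tau0) (ltW tau1) sepC); first by lia.
  rewrite cardC /tau natrX exprD mulnC exprM.
  have : 2 ^+ q != 0 :> R by rewrite expf_neq0.
  set X := 2 ^+ q => X0.
  suff -> : X * (2 * (X * (X ^+ 2 * 2 ^+ 3)^-1)) = 4^-1 by lra.
  by field.
have ln2 : 0 < ln (2 : R) by rewrite ln_gt0 // ltr1n.
apply: (@le_trans _ _ (2 ^+ q)); last first.
  rewrite /log2 ler_pdivlMr // -natrX mulr_natl.
  rewrite -lnXn // ler_ln ?posrE ?exprn_gt0 //.
    by rewrite -natrX ler_nat.
  by rewrite ltr0n (leq_trans _ V_ge) // expn_gt0.
have c0 : 0 <= c.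
  by rewrite mulr_ge0 // divr_ge0 ?ln_ge0 ?ltW // ?ltr1n //; lra.
have c1 : c <= 1 / 4.
  rewrite /c -[leRHS]mulr1 ler_pM2l // /log2 ler_pdivrMr // mul1r.
  by rewrite ler_ln ?posrE //; lra.
(* As [delta <= 1 / 16] and [d < 16 * (q + 1)], the exponent is at most [q + 1]; the lost factor 2
   is absorbed by [c <= 1 / 4]. *)
have pow : 2 `^ (delta * d%:R) <= 2 * 2 ^+ q :> R.
  rewrite -exprS -powR_mulrn // ler_powR ?ler1n //.
  have : d%:R <= 16 * q.+1%:R :> R by rewrite -natrM ler_nat; lia.
  have : 0 <= d%:R :> R by [].
  rewrite /delta; nra.
have pow0 : 0 <= 2 `^ (delta * d%:R) :> R by rewrite powR_ge0.
have cpow0 := mulr_ge0 c0 pow0.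
have cpow : c * 2 `^ (delta * d%:R) <= 1 / 4 * (2 * 2 ^+ q) by rewrite ler_pM.
have := mulr_ge0 cpow0 (ltW eta0); lra.
Qed.
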